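(* The numbers $\lambda_n=\lambda(T(1,n,\infty))$, $n\ge2$, and $\lambda_\infty=\lambda(T(1,\infty,\infty))$ are algebraic integers, and none of these numbers can be obtained as an eigenvalue of a finite graph.
   Context: $T(1,n,\infty)$ is the infinite tree consisting of a central vertex with three rays attached: one with $1$ vertex, one with $n$ vertices and one with (countably) infinitely many vertices (not counting the central vertex); $T(1,\infty,\infty)$ has one ray with $1$ vertex and two infinite rays. $\lambda(\Gamma)$ denotes the largest eigenvalue of (i.e. the norm of) the adjacency matrix of $\Gamma$ acting on $\ell^2$ of the vertices. For $n\ge2$, $\lambda_n=e^x+e^{-x}$ where $x>0$ and $\rho=e^{2x}$ satisfies $\rho^{n+2}-\rho^{n+1}-\rho^n+1=0$; and $\lambda_\infty=\sqrt{2+\sqrt5}$. An eigenvalue of a finite graph is an eigenvalue of its adjacency matrix. *)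

(* Defs.v *)
From HB Require Import structures.
From mathcomp Require Import all_boot all_order all_algebra.
From mathcomp Require Import all_classical all_reals all_analysis.

Set Implicit Arguments.
Unset Strict Implicit.
Unset Printing Implicit Defensive.
Import Order.TTheory GRing.Theory Num.Theory.

Local Open Scope classical_set_scope.
Local Open Scope ring_scope.

(* Undirected graphs, possibly with loops and multiple edges: [edges u v] is
   the number of edges joining u and v, i.e. the (u, v) adjacency entry.
   Simple graphs are those with values in {0, 1} and zero diagonal. *)
Record graph (V : Type) := Graph {
  edges : V -> V -> nat;
  edges_sym : forall u v, edges u v = edges v u
}.

Section FiniteGraph.
Variables (R : realType) (V : finType) (G : graph V).

Definition adjacency_mx : 'M[R]_#|V| :=
  \matrix_(i, j) (edges G (enum_val i) (enum_val j))%:R.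

End FiniteGraph.

Section GraphNorm.
Variables (R : realType) (V : choiceType) (G : graph V).

(* The l^2 norm of f, equal to +oo when f is not square summable. *)
Definition l2norm (f : V -> R) : \bar R :=
  sqrte (\esum_(v in [set: V]) ((f v) ^+ 2)%:E).

(* A sum over the support of its summand: meaningful when G is locally
   finite, since only finitely many terms are then nonzero. *)
Definition adjacency_op (f : V -> R) (v : V) : R :=
  \sum_(w \in [set: V]) (edges G v w)%:R * f w.

(* The operator norm on l^2(V). For a locally finite G the supremum is finite
   iff the adjacency operator is bounded; [fine] maps +oo to 0. *)
Definition lambda : R :=
  fine (ereal_sup [set l2norm (adjacency_op f) |
                   f in [set f : V -> R | (l2norm f <= 1)%E]]).

End GraphNorm.

(* The tree T(a, b, c). The length of a ray is [Some m] or, when infinite,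
   [None]. The centre is [None]; the k-th vertex of the i-th ray, counted from
   the centre and starting at k = 0, is [Some (i, k)]. *)
Section ThreeRays.
Variables a b c : option nat.

Definition on_ray (p : 'I_3 * nat) : bool :=
  if tnth [tuple a; b; c] p.1 is Some m then (p.2 < m)%N else true.

Definition T_vertex : Type := option {p : 'I_3 * nat | on_ray p}.

HB.instance Definition _ := Choice.on T_vertex.

Definition T_adj (u v : T_vertex) : bool :=
  match u, v with
  | None, None => false
  | None, Some q => (val q).2 == 0%N
  | Some p, None => (val p).2 == 0%N
  | Some p, Some q => ((val p).1 == (val q).1) &&
      (((val p).2 == (val q).2.+1) || ((val q).2 == (val p).2.+1))
  end.

Lemma T_adj_sym (u v : T_vertex) : T_adj u v = T_adj v u :> nat.
Proof.
by case: u v => [p|] [q|] //=; rewrite eq_sym [in RHS]orbC.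
Qed.

Definition T_graph : graph T_vertex := Graph T_adj_sym.

End ThreeRays.

Definition algebraic_integer (R : realType) (x : R) : Prop :=
  integralOver (intr : int -> R) x.

Definition finite_graph_eigenvalue (R : realType) (x : R) : Prop :=
  exists (V : finType) (G : graph V), eigenvalue (adjacency_mx R G) x.

(* Main.v *)
Require Import Defs.
From mathcomp Require Import all_boot all_order all_algebra.
From mathcomp Require Import all_classical all_reals all_analysis.
From mathcomp Require Import complex ring lra zify.
Import Order.TTheory GRing.Theory Num.Theory.
Local Open Scope ring_scope.

(** The three assertions about each number follow from two independent facts.

    The norm of the adjacency operator of T(a, b, c) is computed from a positive
    eigenvector.  Put l = t + 1/t with 0 < t < 1, and normalise the vector to be
    1 at the centre.  Along an infinite ray the value at distance j is t^j; along
    a ray with m vertices it is s(m+1-j) / s(m+1) with s(j) = t^(-j) - t^j, which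
    satisfies the same linear recurrence and vanishes just beyond the end of the
    ray.  The eigenvalue equation then holds everywhere off the centre, and at
    the centre it is one equation on t.  All values are at most t^j, so the
    vector is square summable.  A positive square summable eigenvector forces
    the norm to be its eigenvalue: it attains the norm, and the Schur test with
    weights given by the eigenvector shows that the norm is no larger
    ([lambda_positive_eigenvector], [lambda_T]).  With rho = t^(-2) the equation
    at the centre of T(1, n, oo) is rho^(n+2) - rho^(n+1) - rho^n + 1 = 0, and
    this polynomial, divided by rho - 1, changes sign between 1 and 2.  For
    T(1, oo, oo) it is rho^2 = rho + 1.

    An eigenvalue l of a finite graph is an eigenvalue of a real symmetric
    integer matrix A.  The characteristic polynomial of A^2 is rational and all
    its complex roots are nonnegative reals; hence if l^2 = u(x) with u a
    rational polynomial, then u(z) >= 0 for every conjugate z of x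
    ([finite_graph_eigenvalue_conj]).  If x > 1 satisfies x h(x) = 1 for an
    integer polynomial h, then x is irrational, so it has a conjugate z
    different from x ([irrational_conjugate]).

    For l^2 = 2 + sqrt 5 the conjugate is 2 - sqrt 5 < 0.  For
    l^2 = rho + 2 + 1/rho, a conjugate z of rho with z + 2 + 1/z >= 0 is either
    real and positive or of modulus 1.  A second positive root different from 1
    is impossible because y^(n+1) = 1 + y + ... + y^(n-1) determines y > 0.  If
    |z| = 1 then both z and 1/z are roots, and eliminating z^n gives z^2 = 1,
    which would make rho^2 = 1 ([trinomial_conjugate_not_ge0]). *)

Set Implicit Arguments.
Unset Strict Implicit.
Unset Printing Implicit Defensive.

(** * Conjugates of an irrational number *)

(** An algebraic number that is not rational has a conjugate different from itself.
    Conjugacy is expressed without minimal polynomials: x and z are roots of the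
    same rational polynomials. *)
Lemma rational_or_conjugate (C : numClosedFieldType) (x : C) (q : {poly rat}) :
  q != 0 -> root (map_poly ratr q) x ->
  (exists r : rat, x = ratr r) \/
  exists2 z : C, z != x & forall h : {poly rat},
    root (map_poly ratr h) x = root (map_poly ratr h) z.
Proof.
move=> q0 qx.
(* m is a nonzero rational polynomial of least size vanishing at x; the
   conjugate is a root of m / ('X - x), which does not vanish at x because m
   is separable. *)
pose P k := `[< exists2 m : {poly rat}, m != 0 /\ root (map_poly ratr m) x
                 & size m = k >].
have exP : exists k, P k by exists (size q); apply/asboolP; exists q.
case: (ex_minnP exP) => k /asboolP[m [m0 mx] <-] mmin {k exP}.
have {mmin}small (h : {poly rat}) : root (map_poly ratr h) x ->
    (size h < size m)%N -> h = 0.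
  move=> hx; rewrite ltnNge => /negP hm; apply/eqP; apply: contra_notT hm => h0.
  by apply: mmin; apply/asboolP; exists h.
have dvd (h : {poly rat}) : root (map_poly ratr h) x -> m %| h.
  move=> hx; apply/eqP/small; last by rewrite ltn_modp.
  move: hx; rewrite {1}(divp_eq h m) rmorphD rmorphM /= rootE hornerD hornerM.
  by rewrite (rootP mx) mulr0 add0r.
have [s [msE]] : exists s, map_poly ratr m = s * ('X - x%:P) :> {poly C} /\ s != 0.
  move/factor_theorem: mx => [s ms]; exists s; split => //.
  by apply: contra_eq_neq ms => ->; rewrite mul0r map_poly_eq0.
move=> s0.
have sizem : size m = (size s).+1.
  by rewrite -(size_map_poly (ratr : {rmorphism rat -> C})) msE size_Mmonic ?monicXsubC// size_XsubC addn2.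
have [s1|s1] := eqVneq (size s) 1%N.
  left; exists (- m`_0 / m`_1).
  have m1 : m`_1 != 0 by have := lead_coef_eq0 m; rewrite lead_coefE sizem s1 => ->.
  have := rootP mx; rewrite horner_coef size_map_poly sizem s1 !big_ord_recl big_ord0.
  rewrite !coef_map /= expr0 mulr1 addr0 expr1 => e.
  rewrite rmorphM rmorphN fmorphV /=.
  have rm1 : ratr m`_1 != 0 :> C by rewrite fmorph_eq0.
  apply: (mulfI rm1); rewrite mulrCA divff// mulr1; apply/eqP.
  by rewrite eq_sym -subr_eq0 -oppr_eq0 opprB opprK addrC e.
right; have /closed_rootP[z sz] := s1.
have mz : root (map_poly ratr m) z by rewrite msE rootM sz.
have sx : ~~ root s x.
  apply/negP => sx; have : m^`() = 0.
    apply: small; last by rewrite lt_size_deriv.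
    rewrite -deriv_map msE derivM derivXsubC mulr1 rootE hornerD hornerM.
    by rewrite hornerXsubC subrr mulr0 add0r.
  move/(congr1 (fun p : {poly rat} => p`_(size s).-1)); rewrite coef_deriv coef0.
  have s_gt0 : (0 < size s)%N by rewrite lt0n size_poly_eq0.
  rewrite prednK// => /eqP; rewrite mulrn_eq0 -leqn0 leqNgt s_gt0 /=.
  by have := lead_coef_eq0 m; rewrite lead_coefE sizem (negbTE m0) => ->.
exists z; first by apply: contraNneq sx => <-.
move=> h; apply/idP/idP => [/dvd/divpK <-|hz]; first by rewrite rmorphM rootM mz orbT.
(* Conversely, h and m share the root z, so gcdp h m is not constant; were x
   not one of its roots, x would be a root of the smaller m %/ gcdp h m. *)
have gm : gcdp h m %| m by rewrite dvdp_gcdr.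
have gz : root (map_poly ratr (gcdp h m)) z by rewrite gcdp_map root_gcd hz.
have gh : root (map_poly ratr (gcdp h m)) x -> root (map_poly ratr h) x.
  by rewrite gcdp_map root_gcd => /andP[].
have : root (map_poly ratr (m %/ gcdp h m * gcdp h m)) x by rewrite divpK.
rewrite rmorphM rootM => /orP[kx|/gh//].
have g0 : gcdp h m != 0 by rewrite gcdp_eq0 negb_and m0 orbT.
have k0 : m %/ gcdp h m != 0 by rewrite dvdp_div_eq0.
have : (size m <= size (m %/ gcdp h m)%R)%N.
  by rewrite leqNgt; apply: contra k0 => /(small _ kx)/eqP.
rewrite size_divp// => g1.
have {}g1 : (size (gcdp h m) <= 1)%N.
  by move: g1; rewrite leqNgt sizem; case: (size (gcdp h m)) => [|[|j]]//=; rewrite subSS ltnS leq_subr.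
move: gz; rewrite (size1_polyC g1) map_polyC rootC /= fmorph_eq0 => /eqP c0.
by move: g0; rewrite (size1_polyC g1) c0 eqxx.
Qed.

(** The numerator of a rational r with r h(r) = 1 divides a power of its
    denominator, so it is 1 or -1. *)
Lemma rational_unit_le1 (h : {poly int}) (r : rat) :
  r * (map_poly intr h).[r] = 1 -> r <= 1.
Proof.
move=> rh.
(* size h exceeds the degree of h by one, so this power clears denominators. *)
have [k hk] : exists k : int,
    (map_poly intr h).[r] * (denq r)%:~R ^+ size h = k%:~R.
  elim/poly_ind: h {rh} => [|h c [k hk]].
    by exists 0; rewrite map_poly0 horner0 mul0r.
  have [->|h0] := eqVneq h 0.
    exists (c * denq r ^+ size ((0 * 'X + c%:P) : {poly int})).
    by rewrite mul0r add0r map_polyC hornerC rmorphM rmorphXn.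
  have -> : size (h * 'X + c%:P) = (size h).+1.
    rewrite size_polyDl size_mulX// size_polyC.
    by rewrite ltnS; case: (c != 0) => //; rewrite lt0n size_poly_eq0.
  exists (k * numq r + c * denq r ^+ (size h).+1).
  rewrite rmorphD rmorphM /= map_polyX map_polyC !hornerE /= mulrDl.
  by rewrite !rmorphD !rmorphM rmorphXn /= -hk numqE exprS; ring.
have e : numq r * k = denq r ^+ (size h).+1.
  apply: (@intr_inj rat); rewrite rmorphM rmorphXn /= -hk numqE.
  by rewrite mulrACA rh mul1r exprS.
have cop : coprimez (numq r) (denq r ^+ (size h).+1).
  by apply: coprimezXr; exact: coprime_num_den.
have : (numq r %| denq r ^+ (size h).+1 * 1)%Z by rewrite mulr1 -e dvdz_mulr.
rewrite Gauss_dvdzr// dvdz1 => num1.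
have dpos : 0 < (denq r)%:~R :> rat by rewrite ltr0z.
rewrite -(ler_pM2r dpos) mul1r -numqE ler_int.
by rewrite (le_trans (ler_norm _))// -abszE (eqP num1) -gtz0_ge1.
Qed.

(** An x > 1 with x h(x) = 1 is a root of 'X * h - 1, and it is irrational by
    [rational_unit_le1]. *)
Lemma irrational_conjugate (C : numClosedFieldType) (h : {poly int}) (x : C) :
  1 < x -> x * (map_poly intr h).[x] = 1 ->
  exists z : C, [/\ z != x, z * (map_poly intr h).[z] = 1 &
    forall g : {poly rat}, root (map_poly ratr g) x = root (map_poly ratr g) z].
Proof.
move=> x1 xh.
pose q : {poly rat} := 'X * map_poly intr h - 1.
have hE : map_poly ratr (map_poly intr h) = map_poly intr h :> {poly C}.
  by rewrite -map_poly_comp; apply: eq_map_poly => i /=; rewrite ratr_int.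
have qE t : root (map_poly ratr q) t = (t * (map_poly intr h).[t] == 1 :> C).
  rewrite rmorphB rmorphM /= map_polyX hE rmorph1 rootE hornerD hornerM hornerX.
  by rewrite hornerN hornerC subr_eq0.
have qx : root (map_poly ratr q) x by rewrite qE xh.
have q0 : q != 0.
  apply/eqP => /(congr1 (fun p : {poly rat} => p.[0])).
  by rewrite !hornerE ?mul0r; lra.
have [[r xr]|[z zx conjz]] := rational_or_conjugate q0 qx.
  suff : r <= 1 by rewrite -(ler_rat C) rmorph1 -xr (lt_geF x1).
  apply: (@rational_unit_le1 h); apply: (fmorph_inj (ratr : {rmorphism rat -> C})).
  by rewrite rmorphM rmorph1 /= -horner_map /= hE -xr.
by exists z; split=> //; apply/eqP; rewrite -qE -conjz.
Qed.

(** * Conjugates of an eigenvalue of a finite graph *)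

Lemma eigenvalue_sqr_ge0 (C : numClosedFieldType) (n : nat) (A : 'M[C]_n) (b : C) :
  A^T = A -> map_mx Num.conj A = A -> eigenvalue (A *m A) b -> 0 <= b.
Proof.
move=> symA realA /eigenvalueP[v vAA v0].
have dotE (w : 'rV[C]_n) :
    (w *m (map_mx Num.conj w)^T) 0 0 = \sum_j `|w 0 j| ^+ 2.
  by rewrite mxE; apply: eq_bigr => j _; rewrite !mxE normCK.
have dot_ge0 (w : 'rV[C]_n) : 0 <= (w *m (map_mx Num.conj w)^T) 0 0.
  by rewrite dotE sumr_ge0// => j _; rewrite exprn_ge0.
have dot_gt0 : 0 < (v *m (map_mx Num.conj v)^T) 0 0.
  rewrite lt_def dot_ge0 andbT; apply: contra_neq v0 => /eqP.
  rewrite dotE psumr_eq0; last by move=> j _; rewrite exprn_ge0.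
  move=> /allP v0; apply/rowP => j; rewrite mxE; apply/eqP.
  by have := v0 j (mem_index_enum _); rewrite sqrf_eq0 normr_eq0.
have := dot_ge0 (v *m A); rewrite map_mxM realA trmx_mul symA.
by rewrite -mulmxA [A *m _]mulmxA mulmxA vAA -scalemxAl mxE pmulr_lge0.
Qed.

(** Composing the characteristic polynomial of the squared adjacency matrix with u
    gives a rational polynomial vanishing at x, hence at z; so u(z) is an
    eigenvalue of the square of a real symmetric matrix. *)
Lemma finite_graph_eigenvalue_conj (R : realType) (l : R) (u : {poly rat}) (x z : R[i]) :
  finite_graph_eigenvalue l ->
  (map_poly ratr u).[x] = (real_complex R l) ^+ 2 ->
  (forall h : {poly rat}, root (map_poly ratr h) x -> root (map_poly ratr h) z) ->
  0 <= (map_poly ratr u).[z].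
Proof.
move=> [V [G Gl]] ul conjz.
pose A : 'M[rat]_#|V| := \matrix_(i, j) (edges G (enum_val i) (enum_val j))%:R.
pose B : 'M[R[i]]_#|V| := \matrix_(i, j) (edges G (enum_val i) (enum_val j))%:R.
have BA : B = map_mx ratr A by apply/matrixP => i j; rewrite !mxE rmorph_nat.
have BR : B = map_mx (real_complex R) (adjacency_mx R G).
  by apply/matrixP => i j; rewrite !mxE rmorph_nat.
have charE t : root (map_poly ratr (char_poly (A *m A) \Po u)) t =
    eigenvalue (B *m B) (map_poly ratr u).[t].
  rewrite eigenvalue_root_char BA -map_mxM -map_char_poly map_comp_poly.
  by rewrite !rootE horner_comp.
apply: (@eigenvalue_sqr_ge0 _ _ B).
- by apply/matrixP => i j; rewrite !mxE edges_sym.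
- by apply/matrixP => i j; rewrite !mxE rmorph_nat.
rewrite -charE; apply: conjz; rewrite charE ul.
have /eigenvalueP[v vB v0] := Gl.
apply/eigenvalueP; exists (map_mx (real_complex R) v); last by rewrite map_mx_eq0.
rewrite BR -map_mxM -map_mxM mulmxA vB -scalemxAl vB scalerA -expr2.
by rewrite map_mxZ rmorphXn.
Qed.

(** * The trinomial and the quadratic case *)

(** The equation y^n = 1 + y + ... + y^(k-1) has at most one positive solution when
    0 < k <= n.  The proof compares
    y^n (1 + z + ... + z^(k-1)) with z^n (1 + y + ... + y^(k-1)) termwise. *)
Lemma expr_eq_geometric_unique (F : numFieldType) (k n : nat) (y z : F) :
  (0 < k <= n)%N -> 0 < y -> y < z ->
  y ^+ n = \sum_(i < k) y ^+ i -> z ^+ n != \sum_(i < k) z ^+ i.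
Proof.
move=> /andP[k0 kn] y0 yz yn; apply/eqP => zn.
have z0 := lt_trans y0 yz.
have : y ^+ n * (\sum_(i < k) z ^+ i) < z ^+ n * (\sum_(i < k) y ^+ i).
  rewrite !mulr_sumr; apply: ltr_sum => [|i _].
    by apply/hasP; exists (Ordinal k0) => //; rewrite mem_index_enum.
  have -> : n = (n - i + i)%N by rewrite subnK// (leq_trans (ltnW (ltn_ord i))).
  rewrite !exprD -!mulrA [z ^+ i * _]mulrC ltr_pM2r ?mulr_gt0 ?exprn_gt0//.
  rewrite ltr_pXn2r ?nnegrE ?ltW// subn_gt0.
  exact: leq_trans (ltn_ord i) kn.
by rewrite -yn -zn mulrC ltxx.
Qed.

Lemma trinomial_geometric (F : fieldType) (k : nat) (y : F) : y != 1 ->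
  y ^+ (k + 2) - y ^+ (k + 1) - y ^+ k + 1 = 0 ->
  y ^+ k.+1 = \sum_(i < k) y ^+ i.
Proof.
move=> y1 e; have y1' : y - 1 != 0 by rewrite subr_eq0.
apply: (mulfI y1'); rewrite -subrX1 exprS.
apply/eqP; rewrite -subr_eq0 -e; apply/eqP.
by rewrite !exprD expr2 expr1; ring.
Qed.

Lemma conjugate_quadratic (F : fieldType) (x z : F) :
  x * (x - 4) = 1 -> z * (z - 4) = 1 -> z != x -> z = 4 - x.
Proof.
move=> xx zz zx; apply/eqP; rewrite -subr_eq0.
rewrite -(mulrI_eq0 _ (mulfI (_ : z - x != 0))) ?subr_eq0//.
have -> : (z - x) * (z - (4 - x)) = z * (z - 4) - x * (x - 4) by ring.
by rewrite xx zz subrr.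
Qed.

Lemma not_finite_graph_eigenvalue_quadratic (R : realType) (l : R) :
  l ^+ 2 = 2 + Num.sqrt 5 -> ~ finite_graph_eigenvalue l.
Proof.
move=> l2 Gl; pose x : R[i] := real_complex R (2 + Num.sqrt 5).
have s5 : Num.sqrt 5 ^+ 2 = 5 :> R by rewrite sqr_sqrtr.
have s5_gt2 : 2 < Num.sqrt 5 :> R by have := sqrtr_ge0 (5 : R); nra.
have x1 : 1 < x by rewrite -(rmorph1 (real_complex R)) ltcR; lra.
have xx : x * (x - 4) = 1.
  rewrite -(rmorph1 (real_complex R)) -(rmorph_nat (real_complex R) 4).
  by rewrite -rmorphB -rmorphM; congr (real_complex R _); nra.
have [|z [zx]] := @irrational_conjugate _ ('X - 4%:P) x x1.
  by rewrite map_polyXsubC hornerXsubC.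
rewrite map_polyXsubC hornerXsubC => zz conjz.
have zE : z = real_complex R (2 - Num.sqrt 5).
  rewrite (conjugate_quadratic xx zz zx).
  rewrite -(rmorph_nat (real_complex R) 4) -rmorphB; congr (real_complex R _).
  by ring.
have := @finite_graph_eigenvalue_conj _ _ 'X x z Gl.
rewrite map_polyX !hornerX -rmorphXn l2 => /(_ erefl) z_ge0.
have {z_ge0} : 0 <= z by apply: z_ge0 => h; rewrite conjz.
rewrite zE lecR; lra.
Qed.

(** If z and its inverse are both roots of X^(k+2) - X^(k+1) - X^k + 1, then
    z^k (1 + z - z^2) = 1 and the same holds for the inverse w; in the product the
    powers cancel and leave (1 + z - z^2) (1 + w - w^2) = 1. *)
Lemma trinomial_conjugate_pair (F : fieldType) (k : nat) (z w : F) : z * w = 1 ->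
  z ^+ (k + 2) - z ^+ (k + 1) - z ^+ k + 1 = 0 ->
  w ^+ (k + 2) - w ^+ (k + 1) - w ^+ k + 1 = 0 -> z ^+ 2 = 1.
Proof.
move=> zw.
have fE (y : F) : y ^+ (k + 2) - y ^+ (k + 1) - y ^+ k + 1 =
    1 - y ^+ k * (1 + y - y ^+ 2) by rewrite !exprD expr1; ring.
rewrite !fE => /subr0_eq pz /subr0_eq pw.
have e : (1 + z - z ^+ 2) * (1 + w - w ^+ 2) = 1.
  rewrite -[LHS]mul1r -[X in X * _](expr1n F k) -[X in X ^+ k]zw exprMn.
  by rewrite mulrACA -pz -pw mulr1.
have : z ^+ 2 - (z ^+ 2 - 1) ^+ 2 = z ^+ 2.
  rewrite -[RHS]mulr1 -[X in _ * X]e.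
  have -> : z ^+ 2 * ((1 + z - z ^+ 2) * (1 + w - w ^+ 2)) =
    (1 + z - z ^+ 2) * (z ^+ 2 + z * (z * w) - (z * w) ^+ 2) by ring.
  by rewrite zw; ring.
move/eqP; rewrite -subr_eq0 addrAC subrr add0r oppr_eq0 sqrf_eq0 subr_eq0.
by move/eqP.
Qed.

Lemma trinomial_conjugate_not_ge0 (C : numClosedFieldType) (k : nat) (x z : C) :
  (0 < k)%N -> 1 < x -> z != x -> z ^+ 2 != 1 ->
  x ^+ (k + 2) - x ^+ (k + 1) - x ^+ k + 1 = 0 ->
  z ^+ (k + 2) - z ^+ (k + 1) - z ^+ k + 1 = 0 ->
  ~~ (0 <= z + 2 + z^-1).
Proof.
move=> k0 x1 zx z2 px pz; apply/negP => ge0.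
have z0 : z != 0.
  apply: contra_eq_neq pz => ->.
  by rewrite !addnS addn0 !expr0n /= (gtn_eqF k0) !subr0 add0r oner_eq0.
have z1 : z != 1 by apply: contra_neq z2 => ->; rewrite expr1n.
have zN1 : z + 1 != 0.
  by apply: contra_neq z2 => /eqP; rewrite addr_eq0 => /eqP ->; rewrite sqrrN expr1n.
pose w := Num.conj z.
have w0 : w != 0 by rewrite conjC_eq0.
have pw : w ^+ (k + 2) - w ^+ (k + 1) - w ^+ k + 1 = 0.
  transitivity (Num.conj (z ^+ (k + 2) - z ^+ (k + 1) - z ^+ k + 1)).
    by rewrite rmorphD !rmorphB !rmorphXn rmorph1.
  by rewrite pz rmorph0.
(* The number z + 2 + z^-1 is real, hence equal to its conjugate. *)
have : (w - z) * (z * w - 1) = 0.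
  have e : w + 2 + w^-1 = z + 2 + z^-1.
    by rewrite -[RHS](conj_Creal (ger0_real ge0)) 2!rmorphD fmorphV rmorph_nat.
  have -> : (w - z) * (z * w - 1) = z * w * (w + 2 + w^-1 - (z + 2 + z^-1)).
    by field; rewrite z0 w0.
  by rewrite e subrr mulr0.
move/eqP; rewrite mulf_eq0 !subr_eq0 => /orP[wz|/eqP zw]; last first.
  by case/eqP: z2; exact: trinomial_conjugate_pair zw pz pw.
have zreal : z \is Num.real by rewrite CrealE.
have z_gt0 : 0 < z.
  have : 0 <= (z + 1) ^+ 2 * z^-1.
    suff <- : z + 2 + z^-1 = (z + 1) ^+ 2 * z^-1 by [].
    by field.
  rewrite pmulr_rge0 ?invr_ge0 ?lt_def ?z0//.
  by rewrite sqrf_eq0 zN1 -realEsqr realD// real1.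
have x0 : 0 < x by rewrite (lt_trans ltr01).
have xn1 : x != 1 by rewrite gt_eqF.
have gx := trinomial_geometric xn1 px.
have gz := trinomial_geometric z1 pz.
have kk : (0 < k <= k.+1)%N by rewrite k0 leqnSn.
have [zltx|xltz|zex] := real_ltgtP zreal (gtr0_real x0).
- by have := expr_eq_geometric_unique kk z_gt0 zltx gz; rewrite gx eqxx.
- by have := expr_eq_geometric_unique kk x0 xltz gx; rewrite gz eqxx.
- by rewrite zex eqxx in zx.
Qed.

Lemma not_finite_graph_eigenvalue_trinomial (R : realType) (k : nat) (rho l : R) :
  (0 < k)%N -> 1 < rho -> l ^+ 2 = rho + 2 + rho^-1 ->
  rho ^+ (k + 2) - rho ^+ (k + 1) - rho ^+ k + 1 = 0 ->
  ~ finite_graph_eigenvalue l.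
Proof.
case: k => // k _ rho1 l2 prho Gl.
pose x : R[i] := real_complex R rho.
have x1 : 1 < x by rewrite -(rmorph1 (real_complex R)) ltcR.
have px : x ^+ (k.+1 + 2) - x ^+ (k.+1 + 1) - x ^+ k.+1 + 1 = 0.
  transitivity (real_complex R (rho ^+ (k.+1 + 2) - rho ^+ (k.+1 + 1) - rho ^+ k.+1 + 1)).
    by rewrite rmorphD !rmorphB !rmorphXn rmorph1.
  by rewrite prho rmorph0.
(* The trinomial is 1 - t h(t), so at its roots u takes the value t + 2 + t^-1. *)
pose h : {poly int} := 'X^k + 'X^(k.+1) - 'X^(k.+2).
have hE (t : R[i]) : (map_poly intr h).[t] = t ^+ k + t ^+ k.+1 - t ^+ k.+2.
  by rewrite rmorphB rmorphD /= !map_polyXn !hornerE.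
have pE (t : R[i]) : (t * (map_poly intr h).[t] == 1) =
    (t ^+ (k.+1 + 2) - t ^+ (k.+1 + 1) - t ^+ k.+1 + 1 == 0).
  rewrite hE -subr_eq0 -oppr_eq0 !addnS !addn0 !exprS; congr (_ == 0); ring.
have xh : x * (map_poly intr h).[x] = 1 by apply/eqP; rewrite pE px.
have [z [zx zh conjz]] := irrational_conjugate x1 xh.
have hratE (t : R[i]) : (map_poly ratr (map_poly intr h : {poly rat})).[t] =
    (map_poly intr h).[t].
  rewrite -map_poly_comp; congr (_.[t]); apply: eq_map_poly => i /=.
  by rewrite ratr_int.
pose u : {poly rat} := 'X + 2%:P + map_poly intr h.
have uE (t : R[i]) : t * (map_poly intr h).[t] = 1 ->
    (map_poly ratr u).[t] = t + 2 + t^-1.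
  move=> th; rewrite 2!rmorphD /= map_polyX map_polyC !hornerD hornerX hornerC hratE.
  by rewrite /= rmorph_nat -(mulr1_eq th).
have z2 : z ^+ 2 != 1.
  pose g : {poly rat} := 'X^2 - 1.
  have gE t : root (map_poly ratr g) t = (t ^+ 2 == 1 :> R[i]).
    by rewrite rmorphB /= map_polyXn rmorph1 rootE !hornerE subr_eq0.
  by rewrite -gE -conjz gE gt_eqF// exprn_egt1.
have /negP[] := trinomial_conjugate_not_ge0 (ltn0Sn k) x1 zx z2 px
  (eqP (etrans (esym (pE z)) (introT eqP zh))).
rewrite -uE//; apply: (finite_graph_eigenvalue_conj Gl (x := x)); last first.
  by move=> g; rewrite conjz.
by rewrite uE// -rmorphXn l2 2!rmorphD fmorphV rmorph_nat.
Qed.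

(** * The norm of a graph with a positive square summable eigenvector *)

Local Open Scope classical_set_scope.
Local Open Scope ring_scope.

Lemma adjacency_opE (R : realType) (V : choiceType) (G : graph V)
    (r : seq V) (v : V) (f : V -> R) :
  uniq r -> (forall w, edges G v w != 0%N -> w \in r) ->
  adjacency_op G f v = \sum_(w <- r) (edges G v w)%:R * f w.
Proof.
move=> ur rP; rewrite /adjacency_op (fsbigE r)//.
  by apply: eq_bigl => w; rewrite in_setT.
move=> w _; apply: contraNeq; rewrite mulf_eq0 negb_or pnatr_eq0 => /andP[+ _].
exact: rP.
Qed.

Lemma esum_le_finite (R : realType) (V : choiceType) (a : V -> R) (M : \bar R) :
  (forall r : seq V, uniq r -> ((\sum_(v <- r) a v)%:E <= M)%E) ->
  (\esum_(v in [set: V]) (a v)%:E <= M)%E.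
Proof.
move=> aM; apply: ge_ereal_sup => _ /= [X [finX _] <-].
by rewrite fsbig_finite// sumEFin aM// fset_uniq.
Qed.

Lemma sum_le_esum (R : realType) (V : choiceType) (a : V -> R) (r : seq V) :
  uniq r -> ((\sum_(v <- r) a v)%:E <= \esum_(v in [set: V]) (a v)%:E)%E.
Proof.
move=> ur; apply: esum_ge; exists [set` r]; first by split=> //; exact: finite_seq.
by rewrite -fsbig_seq// sumEFin.
Qed.

Lemma esum_scale_le (R : realType) (V : choiceType) (c : R) (a : V -> R) :
  0 <= c -> (forall v, 0 <= a v) ->
  (\esum_(v in [set: V]) (c * a v)%:E <= c%:E * \esum_(v in [set: V]) (a v)%:E)%E.
Proof.
move=> c0 a0; apply: esum_le_finite => r ur.
by rewrite -mulr_sumr EFinM lee_wpmul2l ?lee_fin//; exact: sum_le_esum.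
Qed.

Lemma l2normZ_le (R : realType) (V : choiceType) (c : R) (f : V -> R) : 0 <= c ->
  (l2norm (fun v => (c * f v)%R) <= c%:E * l2norm f)%E.
Proof.
move=> c0; have -> : c%:E = sqrte (c ^+ 2)%:E.
  by rewrite /= sqrtr_sqr ger0_norm.
rewrite /l2norm -sqrteM ?lee_fin ?sqr_ge0// lee_sqrt; last first.
  by rewrite mule_ge0 ?lee_fin ?sqr_ge0// esum_ge0// => v _; rewrite lee_fin sqr_ge0.
have -> : (fun v => ((c * f v) ^+ 2)%:E) = (fun v => (c ^+ 2 * f v ^+ 2)%:E).
  by apply/funext => v; rewrite exprMn.
by apply: esum_scale_le => [|v]; rewrite sqr_ge0.
Qed.

Lemma l2normZ (R : realType) (V : choiceType) (c : R) (f : V -> R) : 0 < c ->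
  l2norm (fun v => c * f v) = (c%:E * l2norm f)%E.
Proof.
move=> c0; apply/eqP; rewrite eq_le l2normZ_le ?(ltW c0)//=.
have -> : l2norm f = l2norm (fun v => c^-1 * (c * f v)).
  by congr l2norm; apply/funext => v; rewrite mulKf ?gt_eqF.
have ci0 : 0 <= c^-1 by rewrite invr_ge0 ltW.
apply: (@le_trans _ _ (c%:E * (c^-1%:E * l2norm (fun v => (c * f v)%R)))%E).
  by rewrite lee_wpmul2l ?lee_fin ?(ltW c0)// l2normZ_le.
by rewrite muleA -EFinM mulfV ?gt_eqF// mul1e.
Qed.

Lemma ler_sum_subset (R : realFieldType) (T : eqType) (r s : seq T) (h : T -> R) :
  uniq r -> uniq s -> {subset r <= s} -> (forall x, 0 <= h x) ->
  \sum_(x <- r) h x <= \sum_(x <- s) h x.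
Proof.
move=> ur us rs h0; rewrite [leRHS](bigID (mem r)) /= -[leLHS]addr0 lerD//.
  rewrite -[leRHS]big_filter le_eqVlt; apply/orP; left; apply/eqP/perm_big.
  apply: uniq_perm => //; first by rewrite filter_uniq.
  by move=> x; rewrite mem_filter; have := rs x; case: (x \in r) => //= ->.
by apply: sumr_ge0.
Qed.

(** Cauchy-Schwarz inequality for a i * g i, split as the product of
    sqrt (a i * f i) and sqrt (a i / f i) * g i. *)
Lemma sqr_sum_le_weighted (R : realFieldType) (I : Type) (r : seq I)
    (a f g : I -> R) : (forall i, 0 <= a i) -> (forall i, 0 < f i) ->
  (\sum_(i <- r) a i * g i) ^+ 2 <=
  (\sum_(i <- r) a i * f i) * \sum_(i <- r) a i * (g i ^+ 2 / f i).
Proof.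
move=> a0 f0; elim: r => [|i r IH]; first by rewrite !big_nil expr0n mul0r.
rewrite !big_cons.
set S := \sum_(j <- r) a j * g j in IH *.
set P := \sum_(j <- r) a j * f j in IH *.
set Q := \sum_(j <- r) a j * (g j ^+ 2 / f j) in IH *.
have P0 : 0 <= P by apply: sumr_ge0 => j _; rewrite mulr_ge0// ltW.
have Q0 : 0 <= Q.
  by apply: sumr_ge0 => j _; rewrite mulr_ge0// divr_ge0 ?sqr_ge0// ltW.
have fi := f0 i; have ai := a0 i.
set h := g i / f i; have -> : g i = f i * h by rewrite /h; field; rewrite gt_eqF.
have -> : (f i * h) ^+ 2 / f i = f i * h ^+ 2 by field; rewrite gt_eqF.
have cross : 2 * h * S <= Q + P * h ^+ 2.
  have [P_gt0|] := ltP 0 P.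
    have sq : 0 <= (P * h - S) ^+ 2 by rewrite sqr_ge0.
    rewrite -(ler_pM2l P_gt0); nra.
  move=> P_le0; have P00 : P = 0 by apply/eqP; rewrite eq_le P_le0.
  have : S ^+ 2 <= 0 by rewrite (le_trans IH)// P00 mul0r.
  rewrite le_eqVlt ltNge sqr_ge0 orbF sqrf_eq0 => /eqP ->.
  by rewrite mulr0 P00 mul0r addr0.
have ih : 0 <= a i * f i * (Q + P * h ^+ 2 - 2 * h * S).
  by rewrite !mulr_ge0 ?subr_ge0// ltW.
nra.
Qed.

(** Schur test: a positive eigenvector bounds the norm of the adjacency operator by
    its eigenvalue.  The function nb bounds the set of neighbours of each vertex
    and thus records local finiteness. *)
Lemma l2norm_adjacency_le (R : realType) (V : choiceType) (G : graph V)
    (nb : V -> seq V) (f g : V -> R) (l : R) :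
  (forall v w, edges G v w != 0%N -> w \in nb v) ->
  (forall v, 0 < f v) -> 0 <= l -> (forall v, adjacency_op G f v = l * f v) ->
  (l2norm (adjacency_op G g) <= l%:E * l2norm g)%E.
Proof.
move=> nbP f0 l0 fE.
have edgeC v w : edges G v w = edges G w v by rewrite edges_sym.
have -> : l%:E = sqrte (l ^+ 2)%:E by rewrite /= sqrtr_sqr ger0_norm.
rewrite /l2norm -sqrteM ?lee_fin ?sqr_ge0// lee_sqrt; last first.
  by rewrite mule_ge0 ?lee_fin ?sqr_ge0// esum_ge0// => v _; rewrite lee_fin sqr_ge0.
apply: esum_le_finite => r ur.
(* The list s contains all neighbours of the vertices of r; after Cauchy-Schwarz
   at each vertex of r, the two finite sums over r and s are exchanged. *)
pose s := undup (flatten [seq nb v | v <- r]).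
have sP v w : v \in r -> edges G v w != 0%N -> w \in s.
  move=> vr vw; rewrite mem_undup; apply/flattenP; exists (nb v); last exact: nbP.
  exact: map_f.
have us : uniq s by exact: undup_uniq.
suff : \sum_(v <- r) adjacency_op G g v ^+ 2 <= l ^+ 2 * \sum_(w <- s) g w ^+ 2.
  rewrite -lee_fin => /le_trans; apply.
  by rewrite EFinM lee_wpmul2l ?lee_fin ?sqr_ge0//; exact: sum_le_esum.
have step v : v \in r -> adjacency_op G g v ^+ 2 <=
    l * \sum_(w <- s) (edges G v w)%:R * f v * (g w ^+ 2 / f w).
  move=> vr; rewrite (adjacency_opE _ us (sP v ^~ vr)).
  apply: (le_trans (sqr_sum_le_weighted s g _ f0)) => //.
  rewrite -(adjacency_opE _ us (sP v ^~ vr)) fE -mulrA ler_wpM2l// mulr_sumr.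
  by apply: ler_sum => w _; rewrite mulrA [f v * _]mulrC.
rewrite big_seq (le_trans (ler_sum _ step))// -big_seq -mulr_sumr expr2 -mulrA.
rewrite ler_wpM2l// exchange_big mulr_sumr; apply: ler_sum => w _ /=.
rewrite -mulr_suml.
have : \sum_(v <- r) (edges G v w)%:R * f v <= l * f w.
  rewrite -fE (@adjacency_opE _ _ _ (undup (r ++ nb w))) ?undup_uniq//; last first.
    by move=> v /nbP; rewrite mem_undup mem_cat orbC => ->.
  under eq_bigr do rewrite edgeC.
  apply: ler_sum_subset; rewrite ?undup_uniq//.
    by move=> v vr; rewrite mem_undup mem_cat vr.
  by move=> v; rewrite mulr_ge0// ltW.
move=> H; have : 0 <= g w ^+ 2 / f w by rewrite divr_ge0 ?sqr_ge0// ltW.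
move=> /ler_wpM2r /(_ _ _ H) /le_trans; apply.
by rewrite le_eqVlt; apply/orP; left; apply/eqP; field; rewrite gt_eqF.
Qed.

(** The vertex v0 makes the vector f nonzero. *)
Lemma lambda_positive_eigenvector (R : realType) (V : choiceType) (G : graph V)
    (nb : V -> seq V) (f : V -> R) (l : R) (v0 : V) :
  (forall v w, edges G v w != 0%N -> w \in nb v) ->
  (forall v, 0 < f v) -> 0 < l -> (forall v, adjacency_op G f v = l * f v) ->
  (l2norm f < +oo)%E -> lambda R G = l.
Proof.
move=> nbP f0 l0 fE fin; rewrite /lambda.
suff -> : ereal_sup [set l2norm (adjacency_op G f0) | f0 in
   [set f1 : V -> R | (l2norm f1 <= 1)%E]] = l%:E by [].
apply/eqP; rewrite eq_le; apply/andP; split.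
  apply: ge_ereal_sup => _ /= [g g1 <-].
  apply: (le_trans (l2norm_adjacency_le g nbP f0 (ltW l0) fE)).
  by rewrite -[leRHS]mule1 lee_wpmul2l ?lee_fin ?(ltW l0).
have N0 : (0 < l2norm f)%E.
  rewrite /l2norm; apply: (@lt_le_trans _ _ (sqrte ((f v0) ^+ 2)%:E)).
    by rewrite /= lte_fin sqrtr_gt0 exprn_gt0.
  rewrite lee_sqrt; last by rewrite esum_ge0// => v _; rewrite lee_fin sqr_ge0.
  by have := @sum_le_esum R V (fun v => f v ^+ 2) [:: v0] isT; rewrite big_seq1.
have : l2norm f \is a fin_num by rewrite ge0_fin_numE ?(ltW N0).
move=> /fineK Nf; set N := fine (l2norm f) in Nf.
have {}N0 : 0 < N by rewrite -lte_fin Nf.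
pose g v := N^-1 * f v.
have g1 : l2norm g = 1%E by rewrite l2normZ ?invr_gt0// -Nf -EFinM mulVf ?gt_eqF.
apply: ereal_sup_ubound; exists g; first by rewrite /= g1.
have gE : adjacency_op G g = fun v => l * g v.
  apply/funext => v; rewrite /adjacency_op /g mulrCA -fE /adjacency_op mulr_fsumr.
  by apply: eq_fsbigr => w _; rewrite mulrCA.
by rewrite gE l2normZ// g1 mule1.
Qed.

(** * The positive eigenvector of a tree with three rays *)

(** The vertices among the points of s, given by ray and position; points beyond
    the end of a finite ray are dropped. *)
Definition on_ray_vertices (a b c : option nat) (s : seq ('I_3 * nat)) :
    seq (T_vertex a b c) :=
  [seq Some q | q <- pmap insub s].

(** The list of neighbours of a vertex.  Positions start at 0, so the vertex at
    position 0 of a ray is adjacent to the centre. *)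
Definition T_neighbours (a b c : option nat) (v : T_vertex a b c) :
    seq (T_vertex a b c) :=
  match v with
  | None => on_ray_vertices a b c [seq (i, 0%N) | i <- enum 'I_3]
  | Some q => let: (i, k) := val q in
      if k is k'.+1 then on_ray_vertices a b c [:: (i, k'); (i, k'.+2)]
      else None :: on_ray_vertices a b c [:: (i, 1%N)]
  end.

Lemma mem_on_ray_vertices (a b c : option nat) (s : seq ('I_3 * nat))
    (w : T_vertex a b c) :
  (w \in on_ray_vertices a b c s) = if w is Some q then val q \in s else false.
Proof.
case: w => [q|]; last by apply/negP => /mapP[].
by rewrite mem_map ?mem_pmap_sub// => x y [].
Qed.

Lemma uniq_on_ray_vertices (a b c : option nat) (s : seq ('I_3 * nat)) :
  uniq s -> uniq (on_ray_vertices a b c s).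
Proof. by move=> us; rewrite map_inj_uniq ?pmap_sub_uniq// => x y []. Qed.

Lemma mem_T_neighbours (a b c : option nat) (v w : T_vertex a b c) :
  (w \in T_neighbours v) = T_adj v w.
Proof.
case: v => [[[i k] ik]|] /=; last first.
  rewrite mem_on_ray_vertices; case: w => [[[j m] jm]|]//=.
  apply/mapP/eqP => [[x _ [_ ->]]//|->]; exists j => //.
  by rewrite mem_enum.
case: k ik => [|k] ik.
  rewrite inE mem_on_ray_vertices; case: w => [[[j m] jm]|]//=.
  by rewrite inE xpair_eqE [j == i]eq_sym; case: m {jm}.
rewrite mem_on_ray_vertices; case: w => [[[j m] jm]|]//=.
by rewrite !inE !xpair_eqE [j == i]eq_sym -andb_orr [m == k]eq_sym eqSS.
Qed.

Lemma uniq_T_neighbours (a b c : option nat) (v : T_vertex a b c) :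
  uniq (T_neighbours v).
Proof.
case: v => [[[i [|k]] ik]|] /=.
- by rewrite mem_on_ray_vertices uniq_on_ray_vertices.
- apply: uniq_on_ray_vertices; rewrite /= inE xpair_eqE eqxx andbT /=.
  by rewrite ltn_eqF// ltnW.
- by apply: uniq_on_ray_vertices; rewrite map_inj_uniq ?enum_uniq// => x y [].
Qed.

(** The function on the tree whose value at distance j from the centre along ray i
    is F i j; the vertex at position k is at distance k + 1, and the value at the
    centre is read off ray 0. *)
Definition ray_function (R : realType) (a b c : option nat)
    (F : 'I_3 -> nat -> R) (v : T_vertex a b c) : R :=
  if v is Some q then F (val q).1 (val q).2.+1 else F ord0 0%N.

Lemma sum_on_ray_vertices (R : realType) (a b c : option nat)
    (F : 'I_3 -> nat -> R) (s : seq ('I_3 * nat)) :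
  (forall i k, ~~ on_ray a b c (i, k) -> F i k.+1 = 0) ->
  \sum_(w <- on_ray_vertices a b c s) ray_function F w = \sum_(p <- s) F p.1 p.2.+1.
Proof.
move=> F0; elim: s => [|[i k] s IH]; first by rewrite !big_nil.
rewrite /on_ray_vertices /= big_cons; case: insubP => [q qray qE|/F0 Fik] /=.
  by rewrite big_cons IH /= qE.
by rewrite Fik add0r.
Qed.

(** When F vanishes beyond the ends of the rays, an end of a finite ray needs no
    separate case. *)
Lemma adjacency_op_ray_function (R : realType) (a b c : option nat)
    (F : 'I_3 -> nat -> R) (v : T_vertex a b c) :
  (forall i, F i 0%N = F ord0 0%N) ->
  (forall i k, ~~ on_ray a b c (i, k) -> F i k.+1 = 0) ->
  adjacency_op (T_graph a b c) (ray_function F) v =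
  if v is Some q then F (val q).1 (val q).2 + F (val q).1 (val q).2.+2
  else \sum_i F i 1%N.
Proof.
move=> Fc F0.
rewrite (adjacency_opE _ (uniq_T_neighbours v)); last first.
  by move=> w; rewrite mem_T_neighbours /=; case: T_adj.
transitivity (\sum_(w <- T_neighbours v) ray_function F w).
  rewrite [LHS]big_seq [RHS]big_seq; apply: eq_bigr => w.
  by rewrite mem_T_neighbours /= => ->; rewrite mul1r.
case: v => [[[i [|k]] ik]|] /=.
- by rewrite big_cons sum_on_ray_vertices// big_seq1 /= Fc.
- by rewrite sum_on_ray_vertices// !big_cons big_nil addr0.
- by rewrite sum_on_ray_vertices// big_map big_enum.
Qed.

(** Square summability by comparison with three geometric series. *)
Lemma l2norm_ray_function (R : realType) (a b c : option nat)
    (F : 'I_3 -> nat -> R) (t : R) : 0 < t < 1 ->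
  (forall i k, 0 <= F i k <= t ^+ k) ->
  (l2norm (@ray_function R a b c F) < +oo)%E.
Proof.
move=> /andP[t0 t1] Ft; rewrite /l2norm.
set M : R := F ord0 0%N ^+ 2 + 3 * (1 - t ^+ 2)^-1.
suff : (\esum_(v in [set: T_vertex a b c]) (ray_function F v ^+ 2)%:E <= M%:E)%E.
  move=> EM; have E0 : (0 <= \esum_(v in [set: T_vertex a b c]) (ray_function F v ^+ 2)%:E)%E.
    by apply: esum_ge0 => v _; rewrite lee_fin sqr_ge0.
  rewrite -ge0_fin_numE ?sqrte_ge0// sqrte_fin_num// ge0_fin_numE//.
  by rewrite (le_lt_trans EM)// ltry.
apply: esum_le_finite => r ur; rewrite lee_fin.
pose h (p : option ('I_3 * nat)) : R :=
  if p is Some p then F p.1 p.2.+1 ^+ 2 else F ord0 0%N ^+ 2.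
have -> : \sum_(v <- r) ray_function F v ^+ 2 = \sum_(p <- map (omap val) r) h p.
  by rewrite big_map; apply: eq_bigr => -[q|].
pose N := (\max_(v <- r) (if v is Some q then (val q).2 else 0%N)).+1.
pose s := None :: [seq Some p | p <- [seq (i, k) | i <- enum 'I_3, k <- iota 0 N]].
have t2 : 0 < 1 - t ^+ 2 by rewrite subr_gt0 expr_lt1// ltW.
apply: (@le_trans _ _ (\sum_(p <- s) h p)).
  apply: ler_sum_subset.
  - rewrite map_inj_uniq// => -[x|] [y|]//= [] xy.
    by congr Some; exact: val_inj.
  - rewrite cons_uniq map_inj_uniq; last by move=> x y [].
    rewrite (allpairs_uniq (f := pair)) ?enum_uniq ?iota_uniq// ?andbT.
      by apply/negP => /mapP[].
    by case=> [i1 k1] [i2 k2].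
  - move=> p /mapP[v vr ->]; rewrite inE; case: v vr => [[[i k] ik]|] vr; last by [].
    apply/orP; right; apply/mapP; exists (i, k) => //.
    apply: allpairs_f; first by rewrite mem_enum.
    rewrite mem_iota add0n leq0n ltnS.
    exact: (leq_bigmax_seq (F := fun v : T_vertex a b c =>
      if v is Some q then (val q).2 else 0%N) _ vr).
  - by move=> [p|]; rewrite sqr_ge0.
rewrite big_cons lerD2l big_map big_allpairs_dep /=.
have geo : \sum_(k <- iota 0 N) (t ^+ 2) ^+ k <= (1 - t ^+ 2)^-1.
  rewrite -[iota 0 N]/(index_iota 0 N) big_mkord -(ler_pM2l t2).
  rewrite mulfV ?gt_eqF// -opprB mulNr -subrX1 opprB gerBl.
  by rewrite exprn_ge0// sqr_ge0.
apply: (@le_trans _ _ (\sum_(i <- enum 'I_3) (1 - t ^+ 2)^-1)).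
  apply: ler_sum => i _; apply: le_trans geo; apply: ler_sum => k _.
  have /andP[F1 F2] := Ft i k.+1.
  rewrite -exprM mulnC exprM ler_sqr ?nnegrE ?exprn_ge0 ?(ltW t0)//.
  by rewrite (le_trans F2)// exprS ler_piMl ?exprn_ge0 ?ltW.
by rewrite big_enum sumr_const card_ord mulr_natl.
Qed.

(** The value of the positive eigenvector at distance j from the centre along a ray
    of length m, with value 1 at the centre.  On a finite ray the truncated
    subtraction makes it vanish at every distance greater than m. *)
Definition ray_profile (R : realType) (t : R) (m : option nat) (j : nat) : R :=
  if m is Some m then
    (t ^- (m.+1 - j) - t ^+ (m.+1 - j)) / (t ^- m.+1 - t ^+ m.+1)
  else t ^+ j.

Lemma exprV_sub_expr_gt0 (R : realType) (t : R) (j : nat) : 0 < t < 1 -> (0 < j)%N ->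
  0 < t ^- j - t ^+ j.
Proof.
move=> /andP[t0 t1] j0; rewrite subr_gt0 (@lt_trans _ _ 1)//.
  by rewrite exprn_ilt1// -?lt0n// ltW.
by rewrite -exprVn exprn_egt1// -?lt0n// invf_gt1.
Qed.

Lemma ray_profile0 (R : realType) (t : R) (m : option nat) :
  0 < t < 1 -> ray_profile t m 0 = 1.
Proof.
move=> t01; case: m => [m|] /=; last by rewrite expr0.
by rewrite subn0 divff// gt_eqF// exprV_sub_expr_gt0.
Qed.

Lemma ray_profile_rec (R : realType) (t : R) (m : option nat) (k : nat) :
  0 < t < 1 -> (if m is Some m then (k < m)%N else true) ->
  ray_profile t m k + ray_profile t m k.+2 = (t + t^-1) * ray_profile t m k.+1.
Proof.
move=> t01; have /andP[t0 _] := t01; have tn0 : t != 0 by rewrite gt_eqF.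
case: m => [m|_] /=; last by rewrite !exprS; field.
move=> km; rewrite -mulrDl mulrA; congr (_ / _).
have [d ->] : exists d, m = (d + k.+1)%N by exists (m - k.+1)%N; rewrite subnK.
have -> : ((d + k.+1).+1 - k = d.+2)%N by lia.
have -> : ((d + k.+1).+1 - k.+1 = d.+1)%N by lia.
have -> : ((d + k.+1).+1 - k.+2 = d)%N by lia.
by rewrite !exprS; field; rewrite tn0 expf_neq0.
Qed.

Lemma ray_profile_gt0 (R : realType) (t : R) (m : option nat) (k : nat) :
  0 < t < 1 -> (if m is Some m then (k < m)%N else true) ->
  0 < ray_profile t m k.+1.
Proof.
move=> t01; have /andP[t0 _] := t01; case: m => [m km|_] /=.
  by rewrite divr_gt0 ?exprV_sub_expr_gt0// subn_gt0.
by rewrite exprn_gt0.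
Qed.

Lemma ray_profile_eq0 (R : realType) (t : R) (m : option nat) (k : nat) :
  ~~ (if m is Some m then (k < m)%N else true) -> ray_profile t m k.+1 = 0.
Proof.
case: m => [m|]//=; rewrite -leqNgt => mk.
have -> : (m.+1 - k.+1 = 0)%N by lia.
by rewrite expr0 invr1 subrr mul0r.
Qed.

Lemma ray_profile_bound (R : realType) (t : R) (m : option nat) (j : nat) :
  0 < t < 1 -> 0 <= ray_profile t m j <= t ^+ j.
Proof.
move=> t01; have /andP[t0 t1] := t01; case: m => [m|] /=; last first.
  by rewrite lexx exprn_ge0 ?ltW.
have s0 := exprV_sub_expr_gt0 t01 (ltn0Sn m).
have [jm|mj] := leqP j m; last first.
  have -> : (m.+1 - j = 0)%N by lia.
  by rewrite expr0 invr1 subrr mul0r lexx exprn_ge0 ?ltW.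
apply/andP; split.
  by rewrite divr_ge0 ?(ltW s0)// ltW// exprV_sub_expr_gt0// subn_gt0 ltnS.
rewrite ler_pdivrMr//.
have [d ->] : exists d, m = (d + j)%N by exists (m - j)%N; rewrite subnK.
have -> : ((d + j).+1 - j = d.+1)%N by lia.
rewrite -addSn mulrBr !exprD.
have tj : t ^+ j != 0 by rewrite expf_neq0 ?gt_eqF.
have -> : t ^+ j / (t ^+ d.+1 * t ^+ j) = t ^- d.+1.
  by field; rewrite tj expf_neq0 ?gt_eqF.
rewrite lerD2l lerN2 mulrCA ler_piMr ?exprn_ge0 ?(ltW t0)//.
by rewrite mulr_ile1 ?exprn_ge0 ?exprn_ile1 ?(ltW t0) ?(ltW t1).
Qed.

(** The hypothesis on the sum is the eigenvalue equation at the centre. *)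
Lemma lambda_T (R : realType) (a b c : option nat) (t : R) : 0 < t < 1 ->
  \sum_(i < 3) ray_profile t (tnth [tuple a; b; c] i) 1 = t + t^-1 ->
  lambda R (T_graph a b c) = t + t^-1.
Proof.
move=> t01 center; have /andP[t0 _] := t01.
pose F (i : 'I_3) j := ray_profile t (tnth [tuple a; b; c] i) j.
have F0 i k : ~~ on_ray a b c (i, k) -> F i k.+1 = 0 by exact: ray_profile_eq0.
have Fc i : F i 0%N = F ord0 0%N by rewrite /F !ray_profile0.
apply: (@lambda_positive_eigenvector R _ _ (@T_neighbours a b c)
  (@ray_function R a b c F) _ None).
- by move=> v w; rewrite mem_T_neighbours /=; case: T_adj.
- case=> [[[i k] ik]|] /=; first exact: ray_profile_gt0.
  by rewrite /F ray_profile0.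
- by rewrite addr_gt0 ?invr_gt0.
- move=> v; rewrite adjacency_op_ray_function//.
  case: v => [[[i k] ik]|] /=; first exact: ray_profile_rec.
  by rewrite center /F ray_profile0// mulr1.
- by apply: (@l2norm_ray_function _ _ _ _ _ t) => [|i k] //; exact: ray_profile_bound.
Qed.

(** * The equation at the centre and algebraic integers *)

Lemma trinomial_root_exists (R : realType) (n : nat) : (2 <= n)%N ->
  exists2 rho : R, 1 < rho & rho ^+ (n + 2) - rho ^+ (n + 1) - rho ^+ n + 1 = 0.
Proof.
(* The trinomial is (y - 1) q(y), with q(1) = 1 - n < 0 < q(2). *)
move=> n2; pose q : {poly R} := 'X^(n.+1) - \sum_(i < n) 'X^i.
have qE y : q.[y] = y ^+ n.+1 - \sum_(i < n) y ^+ i.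
  rewrite hornerD hornerN hornerXn horner_sum; congr (_ - _).
  by apply: eq_bigr => i _; rewrite hornerXn.
have pE y : y ^+ (n + 2) - y ^+ (n + 1) - y ^+ n + 1 = (y - 1) * q.[y].
  by rewrite qE mulrBr -subrX1 [y ^+ n.+1]exprS !exprD; ring.
have q1 : q.[1] < 0.
  rewrite qE expr1n; under eq_bigr do rewrite expr1n.
  by rewrite sumr_const card_ord subr_lt0 ltr1n.
have q2 : 0 < q.[2].
  have <- : (2 - 1) * q.[2] = q.[2] by ring.
  rewrite -pE !exprD expr1; have : 0 < 2 ^+ n :> R by rewrite exprn_gt0.
  by move: (2 ^+ n) => z; lra.
have [||rho] := @poly_ivt R q 1 2.
- by lra.
- by rewrite (ltW q1) (ltW q2).
move=> /andP[rho1 _] /rootP qrho.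
exists rho; last by rewrite pE qrho mulr0.
by rewrite lt_neqAle rho1 andbT; apply: contra_eq_neq qrho => <-; rewrite lt_eqF.
Qed.

Lemma algebraic_integer_sqrt (R : realType) (x : R) :
  algebraic_integer (x ^+ 2) -> algebraic_integer x.
Proof.
case=> p pmon px; exists (p \Po 'X^2).
  rewrite monicE lead_coef_comp ?size_polyXn// (monicP pmon) lead_coefXn.
  by rewrite expr1n mulr1.
by rewrite map_comp_poly /= map_polyXn rootE horner_comp hornerXn.
Qed.

Lemma algebraic_integerX (R : realType) (x : R) (k : nat) :
  algebraic_integer x -> algebraic_integer (x ^+ k).
Proof.
move=> ix; elim: k => [|k IH]; first by rewrite expr0; exact: integral1.
by rewrite exprS; exact: integral_mul.
Qed.

Lemma algebraic_integer_trinomial (R : realType) (n : nat) (y : R) :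
  y ^+ (n + 2) - y ^+ (n + 1) - y ^+ n + 1 = 0 -> algebraic_integer y.
Proof.
move=> e; exists ('X^(n + 2) - ('X^(n + 1) + 'X^n - 1)).
  rewrite monicE lead_coefDl ?lead_coefXn// size_polyN size_polyXn addn2 ltnS.
  rewrite (leq_trans (size_polyD _ _))// geq_max size_polyN size_poly1 andbT.
  rewrite (leq_trans (size_polyD _ _))// geq_max !size_polyXn addn1 leqnn.
  exact: leqnSn.
rewrite rmorphB rmorphB rmorphD /= !map_polyXn rmorph1 rootE !hornerE.
by apply/eqP; rewrite -[RHS]e; ring.
Qed.

(** The inverse of y is y^(n-1) + y^n - y^(n+1). *)
Lemma algebraic_integer_trinomialV (R : realType) (n : nat) (y : R) :
  (0 < n)%N -> y ^+ (n + 2) - y ^+ (n + 1) - y ^+ n + 1 = 0 ->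
  algebraic_integer y^-1.
Proof.
case: n => // n _ e.
have -> : y^-1 = y ^+ n + y ^+ n.+1 - y ^+ n.+2.
  apply: mulr1_eq; apply/eqP; rewrite -subr_eq0 -oppr_eq0 -e; apply/eqP.
  by rewrite !addnS !addn0 !exprS; ring.
have iy := algebraic_integer_trinomial e.
by apply: integral_sub; [apply: integral_add|]; exact: algebraic_integerX.
Qed.

Lemma ray_profile_1 (R : realType) (t : R) : 0 < t < 1 ->
  ray_profile t (Some 1%N) 1 = (t + t^-1)^-1.
Proof.
move=> t01; have := @ray_profile_rec R t (Some 1%N) 0 t01 isT.
rewrite ray_profile0// ray_profile_eq0// addr0 => e.
by rewrite (mulr1_eq (esym e)).
Qed.

(** The equation at the centre of T(1, n, oo), with the contribution t of the
    infinite ray cancelled on both sides. *)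
Lemma center_trinomial (R : realType) (t rho : R) (n : nat) : 0 < t < 1 ->
  t ^+ 2 = rho^-1 -> rho ^+ (n + 2) - rho ^+ (n + 1) - rho ^+ n + 1 = 0 ->
  ray_profile t (Some 1%N) 1 + ray_profile t (Some n) 1 = t^-1.
Proof.
move=> t01 t2 prho; have /andP[t0 _] := t01.
have tn0 : t != 0 by rewrite gt_eqF.
have sn := exprV_sub_expr_gt0 t01 (ltn0Sn n).
rewrite ray_profile_1//= subSS subn0.
set a := t ^+ n; have a0 : a != 0 by rewrite expf_neq0.
(* This is the trinomial in terms of a and t; clearing denominators in the goal
   leads to the same equation. *)
have e : a ^+ 2 * t ^+ 4 = t ^+ 2 + t ^+ 4 - 1.
  have rn : rho ^+ n = (a ^+ 2)^-1.
    by rewrite -[rho]invrK -t2 exprVn -exprM mulnC exprM.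
  move: prho; rewrite !exprD expr1 rn -[rho]invrK -t2.
  have -> : (a ^+ 2)^-1 * (t ^+ 2)^-1 ^+ 2 - (a ^+ 2)^-1 * (t ^+ 2)^-1 - (a ^+ 2)^-1 + 1
    = (1 - t ^+ 2 - t ^+ 4 + a ^+ 2 * t ^+ 4) / (a ^+ 2 * t ^+ 4).
    by field; rewrite a0 tn0.
  have den0 : a ^+ 2 * t ^+ 4 != 0 by rewrite mulf_neq0 ?expf_neq0.
  by move/eqP; rewrite mulf_eq0 invr_eq0 (negbTE den0) orbF => /eqP; lra.
move: sn; rewrite exprS -/a => sn.
have t21 : 0 < t ^+ 2 + 1 by rewrite addr_gt0// exprn_gt0.
have snE : (t * a)^-1 - t * a = (1 - a ^+ 2 * t ^+ 2) / (t * a).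
  by field; rewrite a0 tn0.
have at1 : 1 - a ^+ 2 * t ^+ 2 != 0.
  by move: sn; rewrite snE; apply: contraTneq => ->; rewrite mul0r ltxx.
have -> : (t + t^-1)^-1 = t / (t ^+ 2 + 1).
  by field; rewrite tn0 gt_eqF// -expr2.
have -> : (a^-1 - a) / ((t * a)^-1 - t * a) = t * (1 - a ^+ 2) / (1 - a ^+ 2 * t ^+ 2).
  by rewrite snE; field; rewrite exprMn at1 a0 tn0.
apply: (mulfI (mulf_neq0 (mulf_neq0 tn0 (lt0r_neq0 t21)) at1)).
have -> : t * (t ^+ 2 + 1) * (1 - a ^+ 2 * t ^+ 2) *
   (t / (t ^+ 2 + 1) + t * (1 - a ^+ 2) / (1 - a ^+ 2 * t ^+ 2)) =
   t ^+ 2 * (1 - a ^+ 2 * t ^+ 2) + (t ^+ 2 + 1) * (t ^+ 2 * (1 - a ^+ 2)).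
  by field; rewrite exprMn at1 gt_eqF.
have -> : t * (t ^+ 2 + 1) * (1 - a ^+ 2 * t ^+ 2) * t^-1 =
  (t ^+ 2 + 1) * (1 - a ^+ 2 * t ^+ 2) by field.
apply/eqP; rewrite -subr_eq0.
have -> : t ^+ 2 * (1 - a ^+ 2 * t ^+ 2) + (t ^+ 2 + 1) * (t ^+ 2 * (1 - a ^+ 2)) -
   (t ^+ 2 + 1) * (1 - a ^+ 2 * t ^+ 2) =
   t ^+ 2 + t ^+ 4 - 1 - a ^+ 2 * t ^+ 4 by ring.
by rewrite e subrr.
Qed.

Theorem theorem21p4 (R : realType) :
  (forall n : nat, (2 <= n)%N ->
     let lambda_n : R := lambda R (T_graph (Some 1%N) (Some n) None) in
     [/\ exists x : R,
           let rho := expR (2 * x) in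
           [/\ 0 < x,
               rho ^+ (n + 2) - rho ^+ (n + 1) - rho ^+ n + 1 = 0
             & lambda_n = expR x + expR (- x)],
         algebraic_integer lambda_n
       & ~ finite_graph_eigenvalue lambda_n]) /\
  (let lambda_oo : R := lambda R (T_graph (Some 1%N) None None) in
   [/\ lambda_oo = Num.sqrt (2 + Num.sqrt 5),
       algebraic_integer lambda_oo
     & ~ finite_graph_eigenvalue lambda_oo]).
Proof.
split=> [n n2 lambda_n|lambda_oo].
  have [rho rho1 prho] := trinomial_root_exists R n2.
  have rho0 : 0 < rho by rewrite (lt_trans ltr01).
  pose x : R := ln rho / 2.
  have rhoE : expR (2 * x) = rho by rewrite /x mulrC divfK// lnK.
  have x0 : 0 < x by rewrite divr_gt0// ln_gt0.
  pose t := expR (- x).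
  have t0 : 0 < t by exact: expR_gt0.
  have t1 : t < 1 by rewrite expR_lt1 oppr_lt0.
  have tV : t^-1 = expR x by rewrite -expRN opprK.
  have t2 : t ^+ 2 = rho^-1.
    by rewrite -rhoE -expRN -expRM_natl; congr expR; ring.
  have lE : lambda_n = t + t^-1.
    have t01 : 0 < t < 1 by rewrite t0.
    apply: lambda_T => //; rewrite !big_ord_recl big_ord0 addr0.
    rewrite !(tnth_nth None) /=.
    have prof := @center_trinomial _ _ _ _ t01 t2 prho.
    by move: prof; rewrite /= addrA expr1 => ->; rewrite addrC.
  have l2 : lambda_n ^+ 2 = rho + 2 + rho^-1.
    by rewrite -t2 -[rho]invrK -t2 lE; field; rewrite gt_eqF.
  split.
  - by exists x; rewrite /= rhoE; split=> //; rewrite lE tV addrC.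
  - apply: algebraic_integer_sqrt; rewrite l2.
    apply: integral_add; first apply: integral_add.
    + exact: algebraic_integer_trinomial prho.
    + exact: integral_nat.
    + by apply: algebraic_integer_trinomialV prho; exact: leq_trans n2.
  - apply: not_finite_graph_eigenvalue_trinomial rho1 l2 prho.
    exact: leq_trans n2.
have s5 : Num.sqrt 5 ^+ 2 = 5 :> R by rewrite sqr_sqrtr.
have s5_gt2 : 2 < Num.sqrt 5 :> R by have := sqrtr_ge0 (5 : R); nra.
(* The square of t is the inverse of the golden ratio. *)
pose t : R := Num.sqrt ((Num.sqrt 5 - 1) / 2).
have t2 : t ^+ 2 = (Num.sqrt 5 - 1) / 2 by rewrite sqr_sqrtr//; lra.
have t0 : 0 < t by rewrite sqrtr_gt0; lra.
have t1 : t < 1.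
  rewrite -(@ltr_pXn2r _ 2) ?nnegrE ?ltW// t2 expr1n; nra.
have l2 : (t + t^-1) ^+ 2 = 2 + Num.sqrt 5.
  have -> : (t + t^-1) ^+ 2 = t ^+ 2 + 2 + (t ^+ 2)^-1 by field; rewrite gt_eqF.
  rewrite t2 (@mulr1_eq _ ((Num.sqrt 5 - 1) / 2) ((Num.sqrt 5 + 1) / 2)).
    by lra.
  transitivity ((Num.sqrt 5 ^+ 2 - 1) / 4 : R); first by field.
  by rewrite s5; lra.
have lE : lambda_oo = t + t^-1.
  have t01 : 0 < t < 1 by rewrite t0.
  apply: lambda_T => //; rewrite !big_ord_recl big_ord0 addr0 !(tnth_nth None).
  have := ray_profile_1 t01; rewrite /= expr1 => ->.
  have tn0 : t != 0 by rewrite gt_eqF.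
  have t21 : 0 < t ^+ 2 + 1 by rewrite addr_gt0// exprn_gt0.
  have -> : (t + t^-1)^-1 = t / (t ^+ 2 + 1).
    by field; rewrite tn0 gt_eqF// -expr2.
  have t4 : t ^+ 2 * t ^+ 2 = 1 - t ^+ 2.
    transitivity ((Num.sqrt 5 ^+ 2 - 2 * Num.sqrt 5 + 1) / 4 : R).
      by rewrite t2; field.
    by rewrite s5 t2; lra.
  apply/eqP; rewrite -subr_eq0.
  have -> : t / (t ^+ 2 + 1) + (t + t) - (t + t^-1) =
    (t ^+ 2 * t ^+ 2 + t ^+ 2 - 1) / (t * (t ^+ 2 + 1)).
    by field; rewrite tn0 gt_eqF.
  by rewrite t4 subrK subrr mul0r.
rewrite lE; split.
- by rewrite -l2 sqrtr_sqr gtr0_norm// addr_gt0 ?invr_gt0.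
- apply: algebraic_integer_sqrt; rewrite l2; apply: integral_add.
    exact: integral_nat.
  by apply: algebraic_integer_sqrt; rewrite s5; exact: integral_nat.
- exact: not_finite_graph_eigenvalue_quadratic.
Qed.
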